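(* Consider the $K$-user time-invariant phase-fading complex Gaussian interference channel with unit per-symbol peak-power constraints described in the context. There exists a constant $c>0$ such that, with probability tending to $1$ as $K\to\infty$ (probability over the random channel phases $\{\Theta_{kj}\}$), the realized channel admits an achievable sum-rate of at least $c\,\frac{\ln K}{\ln\ln K}$. In other words, a sum-rate of $\Omega\!\left(\frac{\ln K}{\ln \ln K}\right)$ is achievable with high probability as $K\to\infty$.
   Context: There are $K$ transmitter-receiver pairs indexed by $[K]=\{1,\dots,K\}$. The channel is: for all $k\in[K]$ and time slots $t\in\mathbb{N}$, $Y_k[t]=\sum_{j=1}^K e^{i\Theta_{kj}}X_j[t]+Z_k[t]$, where $X_j[t]\in\mathbb{C}$ is the signal sent by transmitter $j$, $Y_k[t]$ is the signal received at receiver $k$, the noise $Z_k[t]$ is i.i.d. circularly symmetric complex Gaussian $\mathcal{CN}(0,1)$ (independent over $k,t$), and the phases $\{\Theta_{kj}\}_{k,j\in[K]}$ are drawn independently and uniformly from $[-\pi,\pi)$ once and stay fixed over time (time-invariant channel). All transmitters and receivers know all the phases. Inputs satisfy the peak-power constraint $|X_k[t]|^2\le 1$ for all $k,t$. A code of block length $n$ consists of encoders $f_k(n)$ mapping a message $W_k$, uniform on $\{1,\dots,2^{nR_k}\}$, to $X_k^n\in\mathbb{C}^n$, and decoders $\phi_k(n)$ mapping $Y_k^n$ to an estimate $\hat W_k$. A rate vector $(R_1,\dots,R_K)$ is achievable if there is a sequence of such codes with $\mathbb{P}[\hat W_k\ne W_k]\to 0$ as $n\to\infty$ for every $k$; a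 sum-rate $R_{sum}$ is achievable if $R_{sum}=\sum_k R_k$ for some achievable rate vector. ''With high probability'' means with probability (over $\{\Theta_{kj}\}$) tending to $1$ as $K\to\infty$. *)

(* Defs.v *)
From HB Require Import structures.
From mathcomp Require Import all_boot all_order all_algebra.
From mathcomp Require Import all_classical all_reals all_analysis.
Set Implicit Arguments. Unset Strict Implicit. Unset Printing Implicit Defensive.
Import Order.TTheory GRing.Theory Num.Theory.
Local Open Scope classical_set_scope.
Local Open Scope ring_scope.

Section Channel.
Variable R : realType.

(* Complex numbers are represented as pairs (real part, imaginary part). *)
(* e^{i th} * x *)
Definition crot (th : R) (x : R * R) : R * R :=
  (cos th * x.1 - sin th * x.2, sin th * x.1 + cos th * x.2).

Definition cabs2 (x : R * R) : R := x.1 ^+ 2 + x.2 ^+ 2.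

(* Iterated expectation over an n-tuple of i.i.d. coordinates, given the
   one-coordinate expectation functional [I].  For product-measurable
   nonnegative functions this is the expectation under the product law
   (Tonelli). *)
Fixpoint texp (T : Type) (I : (T -> \bar R) -> \bar R) (n : nat) :
  (n.-tuple T -> \bar R) -> \bar R :=
  match n return (n.-tuple T -> \bar R) -> \bar R with
  | 0 => fun f => f [tuple]
  | n'.+1 => fun f => I (fun x => texp I (fun t => f (cons_tuple x t)))
  end.

(* One complex noise sample Z ~ CN(0,1): real and imaginary parts i.i.d.
   N(0, 1/2), i.e. standard deviation sqrt(1/2). *)
Definition noise_sd : R := Num.sqrt (2^-1).
Definition noise_exp (f : R * R -> \bar R) : \bar R :=
  (\int[normal_prob 0 noise_sd]_a \int[normal_prob 0 noise_sd]_b f (a, b))%E.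

Definition phase_exp (f : R -> \bar R) : \bar R :=
  (((2 * pi)^-1)%:E * \int[lebesgue_measure]_(x in `[(- pi)%R, pi[) f x)%E.

Record code (K n : nat) (M : 'I_K -> nat) := Code {
  enc : forall k : 'I_K, 'I_(M k) -> n.-tuple (R * R);
  dec : forall k : 'I_K, n.-tuple (R * R) -> 'I_(M k) }.
Arguments code : clear implicits.
Arguments enc {K n M} c k _.
Arguments dec {K n M} c k _.

(* Peak-power constraint |X_k[t]|^2 <= 1, and measurability of the decoders
   (w.r.t. the Borel product sigma-algebra on C^n = (R*R)^n). *)
Definition code_ok K n M (C : code K n M) : Prop :=
  (forall k w (t : 'I_n), cabs2 (tnth (enc C k w) t) <= 1) /\
  (forall k (m : 'I_(M k)), measurable (dec C k @^-1` [set m])).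

Definition rx K n M (C : code K n M) (Theta : 'I_K -> 'I_K -> R)
  (k : 'I_K) (w : {dffun forall j : 'I_K, 'I_(M j)}) : n.-tuple (R * R) :=
  [tuple \sum_(j < K) crot (Theta k j) (tnth (enc C j (w j)) t) | t < n].

Definition tadd n (x y : n.-tuple (R * R)) : n.-tuple (R * R) :=
  [tuple tnth x t + tnth y t | t < n].

Definition err_prob K n M (C : code K n M) (Theta : 'I_K -> 'I_K -> R)
  (k : 'I_K) : \bar R :=
  (\sum_(w : {dffun forall j : 'I_K, 'I_(M j)})
     ((\prod_(j < K) (M j)%:R)^-1)%:E *
     texp noise_exp (fun z => ((dec C k (tadd (rx C Theta k w) z) != w k))%:R%:E))%E.

Definition nmsg (n : nat) (r : R) : nat := `|Num.ceil (2 `^ (n%:R * r))|%N.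

Definition achievable K (Theta : 'I_K -> 'I_K -> R) (rate : 'I_K -> R) : Prop :=
  (forall k, 0 <= rate k) /\
  exists C : forall n : nat, code K n (fun k => nmsg n (rate k)),
    (forall n, code_ok (C n)) /\
    forall k : 'I_K,
      forall e : R, 0 < e -> exists N : nat, forall n, (N <= n)%N ->
        (err_prob (C n) Theta k <= e%:E)%E.

Definition sumrate_atleast K (Theta : 'I_K -> 'I_K -> R) (s : R) : Prop :=
  exists rate : 'I_K -> R, achievable Theta rate /\ s <= \sum_(k < K) rate k.

Definition phases K (th : (K * K).-tuple R) : 'I_K -> 'I_K -> R :=
  fun k j => tnth th (mxvec_index k j).

Definition phase_prob K (B : set ((K * K).-tuple R)) : \bar R :=
  texp phase_exp (fun th => (\1_B th)%:E).

End Channel.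

(* Main.v *)
Require Import Defs.
From HB Require Import structures.
From mathcomp Require Import all_boot all_order all_algebra.
From mathcomp Require Import all_classical all_reals all_analysis.
From mathcomp Require Import measurable_realfun.
From mathcomp Require Import zify ring lra.
Set Implicit Arguments. Unset Strict Implicit. Unset Printing Implicit Defensive.
Import Order.TTheory GRing.Theory Num.Theory.
Import numFieldNormedType.Exports.
Local Open Scope classical_set_scope.
Local Open Scope ring_scope.

(* Let w = 1 / (8 (m + 1)) with m = floor (ln K / (8 ln ln K)).  Look for m + 1
   users whose direct phases lie in [0, w] and whose mutual cross phases lie in
   [pi/2, pi/2 + w]: if they send real signals and decode from the real part,
   the total interference has amplitude at most 1/8 against a signal of
   amplitude at least 7/8.  Each then gets rate 1/32 from BPSK over a
   Gilbert-Varshamov codebook with correlation decoding (Chernoff and union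
   bounds), while the other users stay silent.
   Each phase is in its interval with probability p = w / (2 pi), so a vertex
   extends a given m-tuple of users with probability at least p^(2m+1), which is
   at least K^(-3/4), independently over the vertices outside the tuple.  A union
   bound over the K^m tuples shows that with high probability every m-tuple can
   be extended, and then a clique of m + 1 users is built greedily. *)

(** * Gaussian noise expectations *)

Section Integrals.
Context {R : realType}.

(* No measurability is needed: the integral of a nonnegative function is a
   supremum over the simple functions below it. *)
Lemma ge0_le_integral_nomeas d (T : measurableType d)
    (mu : {measure set T -> \bar R}) (f g : T -> \bar R) :
  (forall x, 0 <= f x)%E -> (forall x, f x <= g x)%E ->
  (\int[mu]_x f x <= \int[mu]_x g x)%E.
Proof.
move=> f0 fg; have g0 x : (0 <= g x)%E by exact: le_trans (fg x).
rewrite !ge0_integralTE//; apply: le_ereal_sup => _ [h hf <-].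
by exists h => // x; exact: le_trans (hf x) (fg x).
Qed.

Lemma ge0_integral_normal_prob (m s : R) (f : R -> \bar R) :
  (forall x, 0 <= f x)%E -> measurable_fun [set: R] f ->
  (\int[normal_prob m s]_x f x =
   \int[lebesgue_measure]_x (f x * (normal_pdf m s x)%:E))%E.
Proof.
move=> f0 mf; have dom := normal_prob_dominates m s.
rewrite -(Radon_Nikodym_SigmaFinite.change_of_variables dom f0 measurableT mf).
have intg := Radon_Nikodym_SigmaFinite.f_integrable dom.
have mpdf : measurable_fun setT (fun x => (normal_pdf m s x)%:E).
  by apply/measurable_EFinP; exact: measurable_normal_pdf.
apply: ae_eq_integral => //.
- by apply: emeasurable_funM => //; exact: measurable_int intg.
- exact: emeasurable_funM.
apply: ae_eqe_mul2l; apply: integral_ae_eq => // E _ mE.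
by rewrite -(Radon_Nikodym_SigmaFinite.f_integral dom).
Qed.

Lemma normal_mgf (s a : R) : s != 0 ->
  (\int[normal_prob 0 s]_x (expR (a * x))%:E =
   (expR (a ^+ 2 * s ^+ 2 / 2))%:E)%E.
Proof.
move=> s0; have mexp : measurable_fun setT (fun x : R => expR (a * x)).
  by apply: measurableT_comp => //; exact: measurable_funM.
rewrite ge0_integral_normal_prob//; last exact/measurable_EFinP.
  (* complete the square *)
transitivity (\int[lebesgue_measure]_x ((expR (a ^+ 2 * s ^+ 2 / 2))%:E *
    (normal_pdf (a * s ^+ 2) s x)%:E))%E.
  apply: eq_integral => x _.
  rewrite -!EFinM !normal_pdfE //; congr EFin.
  rewrite mulrCA [RHS]mulrCA /normal_fun -!expRD; congr (_ * expR _).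
  by field.
rewrite ge0_integralZl//=; first by rewrite integral_normal_pdf mule1.
- by apply/measurable_EFinP; exact: measurable_normal_pdf.
- by move=> x _; rewrite lee_fin normal_pdf_ge0.
Qed.

Lemma noise_exp_ge0 (f : R * R -> \bar R) :
  (forall x, 0 <= f x)%E -> (0 <= noise_exp f)%E.
Proof. by move=> f0; do 2! apply: integral_ge0 => ? _. Qed.

Lemma le_noise_exp (f g : R * R -> \bar R) :
  (forall x, 0 <= f x)%E -> (forall x, f x <= g x)%E ->
  (noise_exp f <= noise_exp g)%E.
Proof.
move=> f0 fg; apply: ge0_le_integral_nomeas => a; first exact: integral_ge0.
exact: ge0_le_integral_nomeas.
Qed.

Lemma texp_noise_ge0 n (f : n.-tuple (R * R) -> \bar R) :
  (forall z, 0 <= f z)%E -> (0 <= texp (@noise_exp R) f)%E.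
Proof.
elim: n f => [|n IH] f f0 /=; first exact: f0.
by apply: noise_exp_ge0 => x; apply: IH.
Qed.

Lemma le_texp_noise n (f g : n.-tuple (R * R) -> \bar R) :
  (forall z, 0 <= f z)%E -> (forall z, f z <= g z)%E ->
  (texp (@noise_exp R) f <= texp (@noise_exp R) g)%E.
Proof.
elim: n f g => [|n IH] f g f0 fg /=; first exact: fg.
by apply: le_noise_exp => x; [exact: texp_noise_ge0|exact: IH].
Qed.

Lemma noise_exp_sum_expR (I : Type) (s : seq I) (c a : I -> R) :
  (forall i, 0 <= c i) ->
  noise_exp (fun z => (\sum_(i <- s) c i * expR (a i * z.1))%:E) =
  (\sum_(i <- s) c i * expR (a i ^+ 2 / 4))%:E.
Proof.
move=> c0.
transitivity (\int[normal_prob 0 (noise_sd R)]_x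
    (\sum_(i <- s) (c i * expR (a i * x))%:E))%E.
  apply: eq_integral => x _; rewrite /= integral_cst//=.
  rewrite [X in (_ * X)%E](@probability_setT _ _ _ (normal_prob 0 (noise_sd R))).
  by rewrite mule1 sumEFin.
have sd0 : noise_sd R != 0 by rewrite gt_eqF// sqrtr_gt0 invr_gt0.
have mexp i : measurable_fun [set: measurableTypeR R] (fun x => expR (a i * (x : R))).
  by apply: measurableT_comp => //; exact: measurable_funM.
rewrite ge0_integral_sum//=; last 2 first.
- move=> i; apply/measurable_EFinP; exact: measurable_funM.
- by move=> i x _; rewrite lee_fin mulr_ge0// expR_ge0.
rewrite -sumEFin; apply: eq_bigr => i _.
under eq_integral do rewrite EFinM.
rewrite ge0_integralZl//=; last 2 first.
- exact/measurable_EFinP.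
- by rewrite lee_fin.
rewrite normal_mgf// -EFinM sqr_sqrtr ?invr_ge0//.
by rewrite -mulrA -invfM -natrM.
Qed.

Lemma texp_noise_sum_expR n (I : Type) (s : seq I) (c : I -> R)
    (a : I -> 'I_n -> R) :
  (forall i, 0 <= c i) ->
  texp (@noise_exp R) (fun z =>
    (\sum_(i <- s) c i * expR (\sum_t a i t * (tnth z t).1))%:E) =
  (\sum_(i <- s) c i * expR (\sum_t a i t ^+ 2 / 4))%:E.
Proof.
elim: n c a => [|n IH] c a c0 /=.
  by congr EFin; apply: eq_bigr => i _; rewrite !big_ord0.
transitivity (noise_exp (fun x : R * R => (\sum_(i <- s)
    c i * expR (\sum_(t < n) a i (lift ord0 t) ^+ 2 / 4) *
    expR (a i ord0 * x.1))%:E)).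
  congr noise_exp; apply/funext => x.
  transitivity (texp (@noise_exp R) (fun z : n.-tuple (R * R) =>
      (\sum_(i <- s) c i * expR (a i ord0 * x.1) *
         expR (\sum_t a i (lift ord0 t) * (tnth z t).1))%:E)).
    congr texp; apply/funext => z; congr EFin; apply: eq_bigr => i _.
    rewrite big_ord_recl tnth0 expRD mulrA; congr (_ * expR _).
    by apply: eq_bigr => t _; rewrite tnthS.
  rewrite (IH (fun i => c i * expR (a i ord0 * x.1))); last first.
    by move=> i; rewrite mulr_ge0// expR_ge0.
  by congr EFin; apply: eq_bigr => i _; rewrite mulrAC.
rewrite noise_exp_sum_expR; last by move=> i; rewrite mulr_ge0// expR_ge0.
by congr EFin; apply: eq_bigr => i _; rewrite -mulrA -expRD big_ord_recl addrC.
Qed.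

End Integrals.

(** * Random phases and the extension property *)

Section Bernoulli.
Context {R : realType}.

Fixpoint bexp (p : R) n : (n.-tuple bool -> R) -> R :=
  match n return (n.-tuple bool -> R) -> R with
  | 0 => fun F => F [tuple]
  | n'.+1 => fun F => p * bexp p (fun b => F (cons_tuple true b))
                      + (1 - p) * bexp p (fun b => F (cons_tuple false b))
  end.

Lemma bexp_cst p n (c : R) : @bexp p n (fun=> c) = c.
Proof. by elim: n => //= n ->; ring. Qed.

Lemma bexpB p n (F G : n.-tuple bool -> R) :
  bexp p (fun b => F b - G b) = bexp p F - bexp p G.
Proof. by elim: n F G => //= n IH F G; rewrite !IH; ring. Qed.

Lemma bexp_sum p n (I : Type) (s : seq I) (F : I -> n.-tuple bool -> R) :
  bexp p (fun b => \sum_(i <- s) F i b) = \sum_(i <- s) bexp p (F i).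
Proof.
elim: n F => //= n IH F.
by rewrite !IH !mulr_sumr -big_split.
Qed.

Lemma le_bexp p n (F G : n.-tuple bool -> R) : 0 <= p <= 1 ->
  (forall b, F b <= G b) -> bexp p F <= bexp p G.
Proof.
move=> /andP[p0 p1]; elim: n F G => [|n IH] F G FG /=; first exact: FG.
by apply: lerD; apply: ler_wpM2l; rewrite ?subr_ge0//; apply: IH.
Qed.

Lemma bexp_prod p n (D : {set 'I_n}) :
  bexp p (fun b => \prod_(i in D) (tnth b i)%:R) = p ^+ #|D|.
Proof.
rewrite -prodr_const big_mkcond/=.
have -> : (fun b : n.-tuple bool => \prod_(i in D) (tnth b i)%:R) =
    (fun b => \prod_i (if i \in D then (tnth b i)%:R else 1) : R).
  by apply/funext => b; rewrite big_mkcond.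
move: (mem D) => {}D.
elim: n D => [|n IH] D /=; first by rewrite !big_ord0.
have bexpZ (c : R) (F : n.-tuple bool -> R) :
    bexp p (fun b => c * F b) = c * bexp p F.
  by elim: n F {IH D} => //= n IH F; rewrite !IH; ring.
have E v : (fun b : n.-tuple bool => \prod_i
      (if in_mem i D then (tnth (cons_tuple v b) i)%:R else 1)) =
    (fun b => (if in_mem ord0 D then v%:R else 1) *
     \prod_i (if in_mem i (mem [pred i | in_mem (lift ord0 i) D])
              then (tnth b i)%:R else 1) : R).
  apply/funext => b; rewrite big_ord_recl tnth0; congr (_ * _).
  by apply: eq_bigr => i _; rewrite tnthS.
rewrite !E !bexpZ (IH (mem [pred i | in_mem (lift ord0 i) D])).
rewrite big_ord_recl mulrA mulrA -mulrDl; congr (_ * _).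
by case: (in_mem ord0 D) => /=; ring.
Qed.

Lemma bexp_prod_indep p n (U : eqType) (D : U -> {set 'I_n}) (s : seq U)
    (E : {set 'I_n}) :
  uniq s -> {in s &, forall u v, u != v -> [disjoint D u & D v]%B} ->
  {in s, forall u, [disjoint E & D u]%B} ->
  bexp p (fun b => \prod_(i in E) (tnth b i)%:R *
            \prod_(u <- s) (1 - \prod_(i in D u) (tnth b i)%:R)) =
  p ^+ #|E| * \prod_(u <- s) (1 - p ^+ #|D u|).
Proof.
elim: s E => [|u s IH] E /=.
  move=> _ _ _; rewrite big_nil mulr1 -bexp_prod; congr bexp.
  by apply/funext => b; rewrite big_nil mulr1.
move=> /andP[us s_uniq] dD dE.
have sub x : x \in s -> x \in u :: s by rewrite inE => ->; rewrite orbT.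
have dD' : {in s &, forall u v, u != v -> [disjoint D u & D v]%B}.
  by move=> x y /sub xs /sub ys; exact: dD.
have dEu : [disjoint E & D u]%B by apply: dE; rewrite mem_head.
have -> : (fun b : n.-tuple bool => \prod_(i in E) (tnth b i)%:R *
      \prod_(v <- u :: s) (1 - \prod_(i in D v) (tnth b i)%:R)) =
    (fun b => \prod_(i in E) (tnth b i)%:R *
        \prod_(v <- s) (1 - \prod_(i in D v) (tnth b i)%:R) -
      \prod_(i in E :|: D u) (tnth b i)%:R *
        \prod_(v <- s) (1 - \prod_(i in D v) (tnth b i)%:R) : R).
  apply/funext => b; rewrite big_cons.
  have -> : \prod_(i in E :|: D u) (tnth b i)%:R =
      \prod_(i in E) (tnth b i)%:R * \prod_(i in D u) (tnth b i)%:R :> R.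
    by rewrite -bigU//; apply: eq_bigl => i; rewrite !inE.
  by ring.
rewrite bexpB (IH E)//; last by move=> x /sub; exact: dE.
rewrite (IH (E :|: D u))//; last first.
  move=> x xs; rewrite (@eq_disjoint _ _ [predU E & D u]); last first.
    by move=> i; rewrite !inE.
  rewrite disjointU dE ?sub// dD ?mem_head ?sub//.
  by apply: contraNneq us => ->.
have /eqP -> : #|E :|: D u| == (#|E| + #|D u|)%N by rewrite (leq_card_setU _ _).2.
by rewrite big_cons exprD; ring.
Qed.

End Bernoulli.

Section Phases.
Context {R : realType}.

Lemma phase_exp_bit (p : R) (A : set R) (h : bool -> R) :
  measurable A -> A `<=` `[- pi, pi[ ->
  (lebesgue_measure A = (2 * pi * p)%:E)%E ->
  phase_exp (fun x => (h (x \in A))%:E) = (p * h true + (1 - p) * h false)%:E.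
Proof.
move=> mA sA lA; rewrite /phase_exp.
set I := [set` `[- pi, pi[]; have pi0 := @pi_gt0 R.
have mI : measurable I by exact: measurable_itv.
have lI : lebesgue_measure I = (2 * pi)%:E.
  rewrite lebesgue_measure_itv/= lte_fin ifT; last lra.
  by rewrite -EFinB; congr EFin; ring.
have mD : measurable (I `\` A) by exact: measurableD.
have lD : lebesgue_measure (I `\` A) = (2 * pi * (1 - p))%:E.
  rewrite measureD//; last by rewrite [ltLHS]lI ltry.
  rewrite setIidr// [X in (X - _)%E]lI [X in (_ - X)%E]lA -EFinB.
  by congr EFin; ring.
have IE : A `|` I `\` A = I by rewrite setDUK.
rewrite -IE integral_setU//; last 2 first.
- rewrite (_ : (fun x => _) = EFin \o
      (fun x => h false + (h true - h false) * \1_A x)).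
    apply/measurable_EFinP; apply: measurable_funD => //.
    by apply: measurable_funM => //; exact: measurable_indic.
  apply/funext => x; rewrite /= indicE; congr EFin.
  by case: (x \in A) => /=; ring.
- by apply/disj_setPS => x [? []].
rewrite (eq_integral (cst (h true)%:E)); last by move=> x ->.
rewrite [X in (_ + X)%E](eq_integral (cst (h false)%:E)); last first.
  by move=> x /set_mem[_ Ax]; rewrite memNset.
rewrite !integral_cst// [X in (_ * X + _)%E]lA [X in (_ + _ * X)%E]lD.
transitivity ((2 * pi)^-1 * (h true * (2 * pi * p)
    + h false * (2 * pi * (1 - p))))%:E => //.
by congr EFin; move: (@pi R) pi0 => q q0; field; rewrite gt_eqF.
Qed.

Lemma texp_phase_bits (p : R) n (A : 'I_n -> set R) (F : n.-tuple bool -> R) :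
  (forall i, measurable (A i)) -> (forall i, A i `<=` `[- pi, pi[) ->
  (forall i, lebesgue_measure (A i) = (2 * pi * p)%:E)%E ->
  texp (@phase_exp R) (fun th => (F [tuple tnth th i \in A i | i < n])%:E) =
  (bexp p F)%:E.
Proof.
elim: n A F => [|n IH] A F mA sA lA /=.
  by congr (F _)%:E; exact: tuple0.
transitivity (phase_exp (fun x : R =>
    (bexp p (fun b => F (cons_tuple (x \in A ord0) b)))%:E)).
  congr phase_exp; apply/funext => x.
  rewrite -(IH (fun i => A (lift ord0 i)))//.
  congr texp; apply/funext => t; congr (F _)%:E.
  apply: eq_from_tnth => i; rewrite tnth_mktuple.
  case: (unliftP ord0 i) => [j ->|->]; last by rewrite !tnth0.
  by rewrite !tnthS tnth_mktuple.
exact: (@phase_exp_bit p _ (fun v => bexp p (fun b => F (cons_tuple v b)))).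
Qed.

Lemma measurable_fin_preimage d (T : measurableType d) (I : finType)
    (f : T -> I -> bool) (P : set (I -> bool)) :
  (forall i, measurable [set x | f x i]) -> measurable [set x | P (f x)].
Proof.
move=> mf.
have -> : [set x | P (f x)] = \bigcup_(b in [set b : {ffun I -> bool} | P b])
    \bigcap_(i in [set: I]) [set x | f x i = b i].
  apply/seteqP; split => x /=.
    move=> Px; have E : f x = [ffun i => f x i].
      by apply/funext => i; rewrite ffunE.
    by exists [ffun i => f x i]; [rewrite /= -E|move=> i _; rewrite /= -E].
  by case=> b Pb fxb; rewrite (_ : f x = b)//; apply/funext => i; exact: fxb.
apply: fin_bigcup_measurable => // b _.
apply: fin_bigcap_measurable => // i _.
case: (b i); first exact: mf.
rewrite (_ : [set x | _] = ~` [set x | f x i]); first exact: measurableC.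
by apply/seteqP; split => x /=; [move=> ->|move/negP/negbTE].
Qed.

End Phases.

Section Extension.
Context {R : realType} (K m : nat).
Implicit Types (b : (K * K).-tuple bool) (t : m.-tuple 'I_K).

Definition links t (v : 'I_K) : seq 'I_(K * K) :=
  mxvec_index v v ::
  [seq mxvec_index v j | j <- t] ++ [seq mxvec_index j v | j <- t].

Definition extensible b :=
  [forall t : m.-tuple 'I_K, exists v : 'I_K, (v \notin t) && all (tnth b) (links t v)].

Lemma extensible_clique b : (0 < K)%N -> extensible b ->
  exists2 S : {set 'I_K}, #|S| = m.+1 &
    {in S &, forall k j, tnth b (mxvec_index k j)}.
Proof.
move=> K0 /forallP ext.
suff /(_ m.+1 (leqnn _)) [s [ss us sb]] : forall i, (i <= m.+1)%N ->
    exists s : seq 'I_K, [/\ size s = i, uniq s &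
      {in s &, forall k j, tnth b (mxvec_index k j)}].
  exists [set x in s]; first by rewrite cardsE (card_uniqP us).
  by move=> k j; rewrite !inE; exact: sb.
elim=> [_|i IH im]; first by exists [::].
have [s [ss us sb]] := IH (ltnW im).
have st : size (s ++ nseq (m - i) (Ordinal K0)) == m.
  by rewrite size_cat size_nseq ss subnKC.
have /existsP[v] := ext (Tuple st).
rewrite /links /= mem_cat negb_or !map_cat !all_cat /=.
move=> /andP[/andP[vs _]] /and3P[bvv /andP[/allP bv1 _] /andP[/allP bv2 _]].
exists (v :: s); split; rewrite /= ?ss ?vs//.
move=> k j; rewrite !inE => /predU1P[->|ks] /predU1P[->|js]; last exact: sb.
- exact: bvv.
- by apply: bv1; rewrite map_f.
- by apply: bv2; rewrite (map_f (fun j => mxvec_index j v)).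
Qed.

Lemma mxvec_index_inj (k j k' j' : 'I_K) :
  mxvec_index k j = mxvec_index k' j' -> k = k' /\ j = j'.
Proof.
move=> e; have [g gK _] := curry_mxvec_bij K K.
have := congr1 g e; rewrite -[mxvec_index k j]/(uncurry _ (k, j)).
rewrite -[mxvec_index k' j']/(uncurry _ (k', j')) !gK ?inE//.
by case.
Qed.

Lemma links_disjoint t u v : u \notin t -> v \notin t -> u != v ->
  [disjoint [set i in links t u] & [set i in links t v]]%B.
Proof.
move=> ut vt uv.
have inlinks i w : i \in links t w ->
    exists k j, i = mxvec_index k j /\
      ((k = w /\ (j = w \/ j \in t)) \/ (j = w /\ k \in t)).
  rewrite inE => /orP[/eqP ->|]; first by exists w, w; split => //; left; split; [|left].
  rewrite mem_cat => /orP[/mapP[j jt ->]|/mapP[j jt ->]].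
    by exists w, j; split => //; left; split => //; right.
  by exists j, w; split => //; right.
apply/pred0P => i /=; apply/negP; rewrite !inE => /andP[].
move=> /inlinks[k [j [-> ku]]] /inlinks[k' [j' [/mxvec_index_inj[<- <-] kv]]].
move/negP: ut; move/negP: vt; move/eqP: uv.
by case: ku => [[? [?|?]]|[? ?]]; case: kv => [[? [?|?]]|[? ?]]; subst.
Qed.

Lemma bexp_extensible (p : R) : 0 <= p <= 1 ->
  1 - K%:R ^+ m * (1 - p ^+ (m.*2.+1)) ^+ (K - m) <=
  bexp p (fun b => (extensible b)%:R).
Proof.
move=> p01; have /andP[p0 p1] := p01.
pose s t := [seq v <- enum 'I_K | v \notin t].
pose D t v := [set i in links t v].
pose H t b : R := \prod_(v <- s t) (1 - \prod_(i in D t v) (tnth b i)%:R).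
have fact1 b : 1 - \sum_(t : m.-tuple 'I_K) H t b <= (extensible b)%:R.
  have Hge0 t : 0 <= H t b.
    apply: prodr_ge0 => v _; rewrite subr_ge0; apply: prodr_ile1 => i _.
    by rewrite ler0n lern1 leq_b1.
  case: (boolP (extensible b)) => [_|].
    by rewrite lerBlDr lerDl sumr_ge0.
  move=> /forallPn[t /existsPn ht]; rewrite subr_le0 (bigD1 t)//=.
  rewrite [H t b]big1_seq ?lerDl ?sumr_ge0// => v.
  rewrite mem_filter => /= /andP[vt _].
  have := ht v; rewrite vt andTb -has_predC => /hasP[i il bi].
  by rewrite (bigD1 i) ?inE//= (negbTE bi) mul0r subr0.
have bound t : bexp p (H t) <= (1 - p ^+ (m.*2.+1)) ^+ (K - m).
  have E0 b : H t b = \prod_(i in finset.set0 : {set 'I_(K * K)}) (tnth b i)%:R * H t b.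
    by rewrite big_set0 mul1r.
  rewrite (funext E0) bexp_prod_indep; last 3 first.
  - by rewrite filter_uniq// enum_uniq.
  - move=> u v; rewrite !mem_filter => /andP[ut _] /andP[vt _] uv.
    exact: links_disjoint.
  - by move=> u _; rewrite -finset.setI_eq0 finset.set0I.
  rewrite finset.cards0 expr0 mul1r.
  have x01 : 0 <= 1 - p ^+ (m.*2.+1) <= 1.
    by rewrite subr_ge0 exprn_ile1//= gerBl exprn_ge0.
  apply: (@le_trans _ _ (\prod_(v <- s t) (1 - p ^+ (m.*2.+1)))).
    apply: ler_prod => v _; rewrite subr_ge0 exprn_ile1//= lerB//.
    apply: ler_wiXn2l => //; rewrite cardsE (leq_trans (card_size _))//=.
    by rewrite size_cat !size_map size_tuple addnn.
  rewrite big_const_seq iter_mulr_1 count_predT; apply: ler_wiXn2l => //.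
    by case/andP: x01.
    by case/andP: x01.
  have -> : size (s t) = #|[predC (mem t)]|.
    by rewrite cardE /s; congr size; rewrite enumT.
  rewrite -[in leqLHS](card_ord K) -(cardC (mem t)) leq_subLR leq_add2r.
  by rewrite (leq_trans (card_size t))// size_tuple.
apply: le_trans (le_bexp p01 fact1).
rewrite bexpB bexp_cst lerB// bexp_sum.
apply: (@le_trans _ _ (\sum_(t : m.-tuple 'I_K) (1 - p ^+ (m.*2.+1)) ^+ (K - m))).
  by apply: ler_sum => t _; exact: bound.
by rewrite sumr_const card_tuple card_ord -natrX mulr_natl.
Qed.

End Extension.

(** * Coding *)

Section Codebook.
Variable n : nat.
Local Notation word := {ffun 'I_n -> bool}.

Definition hdist (x y : word) : nat := #|[pred t | x t != y t]|.

Lemma hdistC x y : hdist x y = hdist y x.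
Proof. by apply: eq_card => t; rewrite !inE eq_sym. Qed.

(* Weight a word by 4 for each agreement with c: the total weight is
   (4 + 1)^n, and each word of the ball weighs at least 4^(n - d). *)
Lemma card_hball (c : word) d :
  (#|[pred x | (hdist c x <= d)%N]| * 4 ^ (n - d) <= 5 ^ n)%N.
Proof.
have -> : (5 ^ n = \sum_(x : word) \prod_t (if x t == c t then 4 else 1))%N.
  rewrite -(bigA_distr_bigA (fun t b => if b == c t then 4 else 1)%N).
  rewrite (eq_bigr (fun=> 5%N)); first by rewrite prod_nat_const card_ord.
  by move=> t _; rewrite big_bool; case: (c t).
rewrite -sum_nat_const [leqRHS](bigID [pred x | (hdist c x <= d)%N])/=.
apply: leq_trans (leq_addr _ _); apply: leq_sum => x; rewrite inE => xd.
rewrite -big_mkcond/= prod_nat_const leq_exp2l// leq_subLR.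
rewrite -[leqLHS](card_ord n) -(cardC [pred t | c t != x t]) leq_add//.
by apply: subset_leq_card; apply/fintype.subsetP => t; rewrite !inE negbK eq_sym.
Qed.

Lemma gilbert_varshamov d M : (M * 5 ^ n < 2 ^ n * 4 ^ (n - d))%N ->
  exists book : nat -> word,
    forall i j, (i < M)%N -> (j < M)%N -> i != j -> (d < hdist (book i) (book j))%N.
Proof.
elim: M => [_|M IH hM]; first by exists (fun=> [ffun=> false]).
have [|book hbook] := IH; first by apply: leq_ltn_trans hM; rewrite leq_mul2r leqnSn orbT.
have [x /forallP hx] : exists x : word, [forall i : 'I_M, d < hdist (book i) x]%N.
  apply/existsP; apply: contraTT hM => /existsPn hx.
  have -> : (2 ^ n = #|{: word}|)%N by rewrite card_ffun card_bool card_ord.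
  rewrite -leqNgt.
  apply: (@leq_trans ((\sum_(i < M) #|[pred x | (hdist (book i) x <= d)%N]|)
            * 4 ^ (n - d))%N).
    rewrite leq_mul2r; apply/orP; right; rewrite -sum1_card.
    apply: (@leq_trans (\sum_(x : word) \sum_(i < M) (hdist (book i) x <= d)))%N.
      apply: leq_sum => x _; have /forallPn[i] := hx x.
      by rewrite -leqNgt (bigD1 i)//= => ->.
    rewrite exchange_big/=; apply: leq_sum => i _.
    rewrite -sum1_card [leqRHS]big_mkcond/=; apply: leq_sum => x _.
    by rewrite inE; case: (_ <= d)%N.
  rewrite big_distrl/=; apply: (@leq_trans (\sum_(i < M) 5 ^ n)%N).
    by apply: leq_sum => i _; exact: card_hball.
  by rewrite sum_nat_const card_ord leq_mul2r leqnSn orbT.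
exists (fun i => if i == M then x else book i) => i j.
rewrite (ltnS i M) (ltnS j M) (leq_eqVlt i M) (leq_eqVlt j M).
move=> /predU1P[->|iM] /predU1P[->|jM]; rewrite ?eqxx//.
- by rewrite (ltn_eqF jM) hdistC (hx (Ordinal jM)).
- by rewrite (ltn_eqF iM) (hx (Ordinal iM)).
- by rewrite (ltn_eqF iM) (ltn_eqF jM); exact: hbook.
Qed.

End Codebook.

Section Rate.
Context {R : realType}.

Lemma nmsg0 n : nmsg n (0 : R) = 1%N.
Proof. by rewrite /nmsg mulr0 powRr0 -[1]/(1%:~R) intrKceil. Qed.

Lemma nmsg_gt0 n (r : R) : (0 < nmsg n r)%N.
Proof. by rewrite /nmsg absz_gt0 gt_eqF// ceil_gt0 powR_gt0. Qed.

Lemma nmsg_le n : (nmsg n (32^-1 : R) <= 2 ^ (n %/ 32).+1)%N.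
Proof.
have c0 : (0 <= Num.ceil (2 `^ (n%:R / 32) : R))%R by rewrite ltW// ceil_gt0 powR_gt0.
rewrite /nmsg -lez_nat gez0_abs//.
rewrite ceil_le_int -[leRHS]/((_ ^ _)%:R) natrX -powR_mulrn//.
apply: ler_powR; first lra.
rewrite ler_pdivrMr// -natrM ler_nat.
lia.
Qed.

Lemma codebook_exists n : exists book : nat -> {ffun 'I_n -> bool},
  (8 <= n)%N -> forall i j, (i < nmsg n (32^-1 : R))%N -> (j < nmsg n (32^-1 : R))%N ->
    i != j -> (n %/ 8 < hdist (book i) (book j))%N.
Proof.
have [n8|_] := leqP 8 n; last by exists (fun=> [ffun=> false]).
suff /gilbert_varshamov[book hbook] : (nmsg n (32^-1 : R) * 5 ^ n <
    2 ^ n * 4 ^ (n - n %/ 8))%N by exists book.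
have d1 : (0 < n %/ 8)%N by rewrite divn_gt0.
set d := (n %/ 8)%N in d1 *.
rewrite -(@ltn_pmul2r (4 ^ d)) ?expn_gt0// -[ltnRHS]mulnA -expnD.
rewrite subnK; last by rewrite /d leq_div.
rewrite -expnMn -[(2 * 4)%N]/8%N [in (5 ^ n)%N](divn_eq n 8) [in ltnRHS](divn_eq n 8) -/d.
rewrite (expnD 5) (expnD 8); move: (n %% 8)%N => e.
have kd : (n %/ 32 <= d)%N by rewrite /d; lia.
apply: (@leq_ltn_trans (2 ^ d.+1 * (5 ^ (d * 8) * 8 ^ e) * 4 ^ d)%N).
  rewrite leq_mul2r; apply/orP; right; apply: leq_mul.
    by rewrite (leq_trans (nmsg_le n))// leq_exp2l.
  rewrite leq_mul2l; apply/orP; right.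
  by case: e => // e; rewrite leq_exp2r.
rewrite mulnA mulnAC ltn_pmul2r ?expn_gt0//.
have -> : (d * 8 = 3 * (2 * d) + 2 * d)%N by ring.
rewrite (expnD 5) (expnD 8).
have h1 : (4 ^ (2 * d) * 5 ^ (3 * (2 * d)) <= 8 ^ (3 * (2 * d)))%N.
  by rewrite (expnM 5) (expnM 8) -expnMn leq_exp2r// muln_gt0.
have h2 : (2 ^ d * 5 ^ (2 * d) <= 8 ^ (2 * d))%N.
  by rewrite (expnM 5) (expnM 8) -expnMn leq_exp2r.
apply: leq_trans (leq_mul h1 h2).
have h3 : (2 < 4 ^ d)%N by rewrite (@leq_trans (4 ^ 1))// leq_exp2l.
rewrite expnS (mul2n d) -addnn (expnD 4).
move: (expn_gt0 2 d) (expn_gt0 4 d) (expn_gt0 5 (3 * (d + d))) (expn_gt0 5 (d + d)).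
move: (2 ^ d)%N (4 ^ d)%N (5 ^ (3 * (d + d)))%N (5 ^ (d + d))%N h3 =>
  /= w x y z h3 w0 x0 y0 z0.
rewrite (_ : 2 * w * _ * _ = 2 * (w * x * y * z))%N; last by ring.
rewrite [X in (_ < X)%N](_ : _ = x * (w * x * y * z))%N; last by ring.
by rewrite ltn_pmul2r// !muln_gt0 w0 x0 y0 z0.
Qed.

End Rate.

Section Scheme.
Context {R : realType} (K : nat) (S : {set 'I_K}) (Theta : 'I_K -> 'I_K -> R).
Variables (n : nat) (M : 'I_K -> nat) (M_gt0 : forall k, (0 < M k)%N).
Variable book : nat -> {ffun 'I_n -> bool}.

Definition sgn (b : bool) : R := if b then 1 else -1.

Definition scheme_enc (k : 'I_K) (w : 'I_(M k)) : n.-tuple (R * R) :=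
  [tuple (if k \in S then sgn (book w t) else 0, 0) | t < n].

Definition score (y : n.-tuple (R * R)) (w : nat) : R :=
  \sum_t sgn (book w t) * (tnth y t).1.

Definition best k (g : 'I_(M k) * 'I_(M k) -> bool) : 'I_(M k) :=
  odflt (Ordinal (M_gt0 k)) [pick w | [forall w', g (w', w)]].

Definition scheme_dec k (y : n.-tuple (R * R)) : 'I_(M k) :=
  best (fun p : 'I_(M k) * 'I_(M k) => score y p.1 <= score y p.2).

Definition scheme : Defs.code R n M := Code scheme_enc scheme_dec.

Lemma measurable_score w : measurable_fun [set: n.-tuple (R * R)] (score ^~ w).
Proof.
apply: measurable_sum => t; apply: measurable_funM => //.
by apply: measurableT_comp => //; exact: measurable_tnth.
Qed.

Lemma scheme_ok : code_ok scheme.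
Proof.
split=> [k w t|k m].
  rewrite tnth_mktuple /cabs2 /= expr0n addr0 /sgn.
  case: ifP => _; last by rewrite expr0n.
  by case: (book w t); rewrite ?sqrrN expr1n.
have mle (p : 'I_(M k) * 'I_(M k)) :
    measurable [set y : n.-tuple (R * R) | score y p.1 <= score y p.2].
  rewrite -[X in measurable X]setTI.
  by apply: measurable_fun_le => //; exact: measurable_score.
exact: (@measurable_fin_preimage _ _ _ _ (fun g => best g = m) mle).
Qed.

Lemma rx_fst k (w : {dffun forall j, 'I_(M j)}) t :
  (tnth (rx scheme Theta k w) t).1 =
  \sum_(j in S) cos (Theta k j) * sgn (book (w j) t).
Proof.
rewrite tnth_mktuple (big_morph fst (id1 := 0) (op1 := +%R))//.
rewrite [RHS]big_mkcond; apply: eq_bigr => j _.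
rewrite tnth_mktuple /= mulr0 subr0.
by case: ifP; rewrite ?mulr0.
Qed.

Lemma sgn_norm b : `|sgn b| = 1.
Proof. by case: b; rewrite /sgn ?normrN normr1. Qed.

Definition aligned k :=
  3 / 4 <= cos (Theta k k) - \sum_(j in S | j != k) `|cos (Theta k j)|.

Lemma sgn_rx k (w : {dffun forall j, 'I_(M j)}) t : k \in S -> aligned k ->
  3 / 4 <= sgn (book (w k) t) * (tnth (rx scheme Theta k w) t).1.
Proof.
move=> kS al; rewrite rx_fst (bigD1 k)//= mulrDr.
have ss b : sgn b * sgn b = 1 by case: b; rewrite /sgn; ring.
rewrite mulrCA ss mulr1; apply: le_trans al _; rewrite lerD2l lerNl.
apply: le_trans (ler_norm _) _; rewrite normrN normrM sgn_norm mul1r.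
apply: le_trans (ler_norm_sum _ _ _) _; apply: ler_sum => j _.
by rewrite normrM sgn_norm mulr1.
Qed.

Lemma scheme_dec_err k (y : n.-tuple (R * R)) (w : 'I_(M k)) :
  scheme_dec k y != w -> exists2 w' : 'I_(M k), w' != w & score y w <= score y w'.
Proof.
rewrite /scheme_dec /best; case: pickP => [v /forallP hv vw|nopick _].
  by exists v => //; exact: hv w.
have /negbT/forallPn[v] := nopick w; rewrite -ltNge => hv.
by exists v; [apply: contraTneq hv => ->; rewrite ltxx|exact: ltW].
Qed.

(* Chernoff bound with parameter 1/2, then the union bound over wrong
   codewords. *)
Lemma scheme_err_active k (d : nat) (w : {dffun forall j, 'I_(M j)}) :
  k \in S -> aligned k ->
  (forall i j, (i < M k)%N -> (j < M k)%N -> i != j ->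
     (d <= hdist (book i) (book j))%N) ->
  (texp (@noise_exp R) (fun z =>
     (scheme_dec k (tadd (rx scheme Theta k w) z) != w k)%:R%:E) <=
   ((M k)%:R * expR (- (d%:R / 2)))%:E)%E.
Proof.
move=> kS al hd; set x := rx scheme Theta k w.
pose s := [seq w' <- enum 'I_(M k) | w' != w k].
pose a (w' : 'I_(M k)) t : R := (sgn (book w' t) - sgn (book (w k) t)) / 2.
pose c w' : R := expR (\sum_t a w' t * (tnth x t).1).
apply: (@le_trans _ _ (texp (@noise_exp R) (fun z =>
    (\sum_(w' <- s) c w' * expR (\sum_t a w' t * (tnth z t).1))%:E))).
  apply: le_texp_noise => z; rewrite lee_fin ?ler0n//.
  have pos w' : 0 <= c w' * expR (\sum_t a w' t * (tnth z t).1).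
    by rewrite mulr_ge0 ?expR_ge0.
  case: (boolP (scheme_dec _ _ != _)) => [/scheme_dec_err[v vw hv]|_]; last first.
    by apply: sumr_ge0.
  have vs : v \in s by rewrite mem_filter vw mem_enum.
  rewrite (big_rem v)//= -[leLHS]addr0 lerD//; last exact: sumr_ge0.
  rewrite /c -expRD -expR0 ler_expR -big_split/=.
  rewrite (eq_bigr (fun t => (sgn (book v t) * (tnth (tadd x z) t).1 -
      sgn (book (w k) t) * (tnth (tadd x z) t).1) / 2)); last first.
    move=> t _; have -> : (tnth (tadd x z) t).1 = (tnth x t).1 + (tnth z t).1.
      exact: (congr1 fst (tnth_mktuple _ _)).
    by rewrite /a; ring.
  by rewrite -mulr_suml sumrB divr_ge0// subr_ge0.
rewrite texp_noise_sum_expR; last by move=> w'; exact: expR_ge0.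
rewrite lee_fin; apply: (@le_trans _ _ (\sum_(w' <- s) expR (- (d%:R / 2)))).
  rewrite big_seq_cond [leRHS]big_seq_cond; apply: ler_sum => v.
  rewrite andbT mem_filter => /andP[vw _].
  rewrite /c -expRD ler_expR -big_split/=.
  apply: (@le_trans _ _ (\sum_(t | book v t != book (w k) t) - (1 / 2))).
    rewrite [leRHS]big_mkcond; apply: ler_sum => t _.
    have := sgn_rx w t kS al; rewrite -/x /a /sgn.
    by case: (book v t); case: (book (w k) t) => /= h; lra.
  rewrite sumr_const -[leLHS]mulr_natr.
  have : (d%:R <= (hdist (book v) (book (w k)))%:R :> R) by rewrite ler_nat hd.
  rewrite /hdist; lra.
rewrite big_const_seq iter_addr addr0 count_predT -[leLHS]mulr_natl.
apply: ler_wpM2r; first exact: expR_ge0.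
by rewrite ler_nat size_filter (leq_trans (count_size _ _))// size_enum_ord.
Qed.

Lemma texp_noise0 m : texp (@noise_exp R) (fun=> 0%E : \bar R) (n := m) = 0%E.
Proof.
transitivity (texp (@noise_exp R) (fun z : m.-tuple (R * R) =>
    (\sum_(i <- [::] : seq unit) 0 * expR (\sum_t 0 * (tnth z t).1))%:E)).
  by congr texp; apply/funext => z; rewrite big_nil.
by rewrite (texp_noise_sum_expR _ (fun=> fun=> 0))// big_nil.
Qed.

Lemma err_prob_le k (e : R) :
  (forall w : {dffun forall j, 'I_(M j)}, (texp (@noise_exp R) (fun z =>
     (scheme_dec k (tadd (rx scheme Theta k w) z) != w k)%:R%:E) <= e%:E)%E) ->
  (err_prob scheme Theta k <= e%:E)%E.
Proof.
move=> he; rewrite /err_prob.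
apply: (@le_trans _ _ (\sum_(w : {dffun forall j, 'I_(M j)})
    ((\prod_(j < K) (M j)%:R)^-1 * e)%:E)%E).
  apply: lee_sum => w _; rewrite EFinM; apply: lee_wpmul2l; last exact: he.
  by rewrite lee_fin invr_ge0 prodr_ge0.
rewrite sumEFin lee_fin sumr_const.
have -> : (#|{dffun forall j : 'I_K, 'I_(M j)}| = \prod_(j < K) M j)%N.
  rewrite card_dep_ffun foldrE big_image/=.
  by apply: eq_bigr => j _; rewrite card_ord.
rewrite -mulr_natl mulrA natr_prod divff ?mul1r//.
by apply/prodf_neq0 => j _; rewrite pnatr_eq0 -lt0n.
Qed.

End Scheme.

Section Achievability.
Context {R : realType}.

Lemma union_bound_small n (e : R) : 0 < e ->
  (32 * Num.bound (2 / e) <= n)%N ->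
  (nmsg n (32^-1 : R))%:R * expR (- ((n %/ 8)%:R / 2)) <= e.
Proof.
move=> e0 hn; set q := (n %/ 32)%N.
have q8 : (4 * q <= n %/ 8)%N by rewrite /q; lia.
have qb : (Num.bound (2 / e)%R <= q)%N by rewrite /q leq_divRL// mulnC.
have e2 : 2 <= expR 1 :> R by have := expR_ge1Dx (1 : R); lra.
have exp_small : expR (- ((n %/ 8)%:R / 2)) <= (4 ^+ q)^-1 :> R.
  rewrite expRN lef_pV2 ?posrE ?expR_gt0 ?exprn_gt0//.
  apply: (@le_trans _ _ (expR (2 * q%:R))).
    rewrite mulrC expRM_natl lerXn2r ?nnegrE ?expR_ge0//.
    rewrite (_ : (4 : R) = 2 ^+ 2); last by rewrite expr2; lra.
    by rewrite -[2 in leRHS]mulr1 expRM_natl lerXn2r ?nnegrE ?expR_ge0.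
  rewrite ler_expR; have : ((4 * q)%:R <= (n %/ 8)%:R :> R) by rewrite ler_nat.
  by rewrite natrM; lra.
have msg_small : (nmsg n (32^-1 : R))%:R <= 2 * 2 ^+ q :> R.
  by rewrite -exprS -natrX ler_nat nmsg_le.
apply: (@le_trans _ _ (2 * 2 ^+ q * (4 ^+ q)^-1)).
  by apply: ler_pM => //; rewrite ?expR_ge0.
have -> : 4 ^+ q = 2 ^+ q * 2 ^+ q :> R.
  by rewrite -exprMn_comm ?/GRing.comm//; congr (_ ^+ _); lra.
have q2 : 0 < 2 ^+ q :> R by rewrite exprn_gt0.
rewrite invfM mulrA mulfK ?gt_eqF// ler_pdivrMr// -ler_pdivrMl// mulrC.
have /ltW/le_trans := archi_boundP (divr_ge0 (ler0n R 2) (ltW e0)); apply.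
rewrite -natrX ler_nat; apply: leq_trans qb _.
exact/ltnW/ltn_expl.
Qed.

Lemma aligned_achievable K (Theta : 'I_K -> 'I_K -> R) (S : {set 'I_K}) :
  {in S, forall k, aligned S Theta k} ->
  achievable Theta (fun k => if k \in S then 32^-1 else 0).
Proof.
move=> al; set rate := fun k => _.
split=> [k|]; first by rewrite /rate; case: ifP.
pose book n := sval (cid (codebook_exists (R := R) n)).
have hbook n := svalP (cid (codebook_exists (R := R) n)).
exists (fun n => scheme S (fun k => nmsg_gt0 n (rate k)) (book n)).
split=> [n|k e e0]; first exact: scheme_ok.
have [kS|kS] := boolP (k \in S).
  exists (maxn 8 (32 * Num.bound (2 / e))) => n.
  rewrite geq_max => /andP[n8 hn]; apply: err_prob_le => w.
  apply: le_trans (scheme_err_active (d := (n %/ 8)%N) _ w kS (al k kS) _) _.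
    move=> i j; rewrite /rate kS => iM jM ij.
    exact/ltnW/(hbook n n8).
  by rewrite lee_fin /rate kS; exact: union_bound_small.
exists 0%N => n _; apply: err_prob_le => w.
rewrite (_ : (fun z => _) = (fun=> 0%E)); first by rewrite texp_noise0 lee_fin ltW.
apply/funext => z; rewrite (_ : _ == _); first by [].
apply/eqP/val_inj.
have triv (x : 'I_(nmsg n (rate k))) : val x = 0%N.
  by case: x => x /=; rewrite /rate (negbTE kS) nmsg0; case: x.
by rewrite !triv.
Qed.

End Achievability.

(** * Alignment and asymptotics *)

Section Geometry.
Context {R : realType}.

Lemma sin_le (x : R) : 0 <= x -> sin x <= x.
Proof.
move=> x0.
have [|c _] := @MVT_segment R sin cos 0 x x0.
  by apply: continuous_subspaceT; move=> ?; exact: continuous_sin.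
rewrite sin0 !subr0 => ->.
by rewrite -[leRHS]mul1r ler_wpM2r// cos_le1.
Qed.

Lemma cos_ge (x : R) : 0 <= x -> 1 - x <= cos x.
Proof.
move=> x0.
have [|c _] := @MVT_segment R cos (fun y => - sin y) 0 x x0.
  by apply: continuous_subspaceT; move=> ?; exact: continuous_cos.
rewrite cos0 !subr0 => h.
have : (1 - sin c) * x >= 0 by rewrite mulr_ge0// subr_ge0 sin_le1.
lra.
Qed.

Definition phase_set K (w : R) (i : 'I_(K * K)) : set R :=
  if i \in [seq mxvec_index v v | v <- enum 'I_K] then `[0, w]%classic
  else `[pi / 2, pi / 2 + w]%classic.

Lemma phase_set_diag K w (k : 'I_K) : phase_set w (mxvec_index k k) = `[0, w]%classic.
Proof. by rewrite /phase_set (map_f (fun v => mxvec_index v v)) ?mem_enum. Qed.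

Lemma phase_set_off K w (k j : 'I_K) : j != k ->
  phase_set w (mxvec_index k j) = `[pi / 2, pi / 2 + w]%classic.
Proof.
move=> jk; rewrite /phase_set; case: ifP => // /mapP[v _ /mxvec_index_inj[kv jv]].
by rewrite kv jv eqxx in jk.
Qed.

Lemma measurable_phase_set K w (i : 'I_(K * K)) : measurable (phase_set w i).
Proof. by rewrite /phase_set; case: ifP => _; exact: measurable_itv. Qed.

Lemma phase_set_sub K w (i : 'I_(K * K)) : w < 1 -> phase_set w i `<=` `[- pi, pi[.
Proof.
move=> w1 x; have := @pi_ge2 R; rewrite /phase_set.
by case: ifP => _ pi2; rewrite /= !in_itv/= => /andP[x0 xw]; apply/andP; split; lra.
Qed.

Lemma lebesgue_phase_set K w (i : 'I_(K * K)) : 0 < w ->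
  (lebesgue_measure (phase_set w i) = w%:E)%E.
Proof.
move=> w0; rewrite /phase_set; case: ifP => _; rewrite lebesgue_measure_itv/= lte_fin.
  by rewrite w0 -EFinB subr0.
by rewrite ltrDl w0 -EFinB addrAC subrr add0r.
Qed.

Lemma aligned_of_phase_set K m (th : (K * K).-tuple R) (S : {set 'I_K}) :
  #|S| = m.+1 ->
  {in S &, forall k j, phase_set (8 * m.+1%:R)^-1 (mxvec_index k j)
                         (tnth th (mxvec_index k j))} ->
  {in S, forall k, aligned S (phases th) k}.
Proof.
set w := _^-1 => Sm hS k kS; rewrite /aligned.
have m0 : 1 <= m.+1%:R :> R by rewrite ler1n.
have w8 : w * m.+1%:R = 8^-1.
  by rewrite /w invfM mulfVK// gt_eqF// (lt_le_trans _ m0).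
have w0 : 0 < w by rewrite invr_gt0 mulr_gt0// (lt_le_trans _ m0).
have wle : w <= 8^-1 by rewrite -w8 ler_peMr// ltW.
have hkk : 7 / 8 <= cos (phases th k k).
  have := hS k k kS kS; rewrite phase_set_diag /= in_itv/= => /andP[x0 xw].
  by apply: le_trans (cos_ge x0); rewrite /phases in xw *; lra.
have hkj j : j \in S -> j != k -> `|cos (phases th k j)| <= w.
  move=> jS jk; have := hS k j kS jS; rewrite phase_set_off//= in_itv/=.
  rewrite /phases; set x := tnth _ _ => /andP[x0 xw].
  have := @cosDpihalf R (x - pi / 2); rewrite subrK => ->.
  rewrite normrN ger0_norm; last first.
    apply: sin_ge0_pi; rewrite subr_ge0 x0/=.
    by have := @pi_ge2 R; lra.
  by apply: le_trans (sin_le _) _; [rewrite subr_ge0|lra].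
have : \sum_(j in S | j != k) `|cos (phases th k j)| <= 8^-1.
  apply: (@le_trans _ _ (\sum_(j in S | j != k) w)).
    by apply: ler_sum => j /andP[]; exact: hkj.
  apply: (@le_trans _ _ (\sum_(j in S) w)).
    by rewrite [leRHS](bigD1 k)//= lerDr ltW.
  by rewrite sumr_const Sm -[leLHS]mulr_natr w8.
lra.
Qed.

End Geometry.

Section Asymptotics.
Context {R : realType}.

Lemma expR_ge_pow n (x : R) : 0 <= x -> (x / n.+1%:R) ^+ n.+1 <= expR x.
Proof.
move=> x0; have -> : expR x = expR (x / n.+1%:R) ^+ n.+1.
  by rewrite -expRM_natl mulrC divfK// pnatr_eq0.
rewrite lerXn2r ?nnegrE ?expR_ge0 ?divr_ge0//.
by apply: le_trans (expR_ge1Dx _); rewrite lerDr.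
Qed.

Lemma failure_small (K m : nat) (p L : R) :
  512 <= L -> K%:R = expR L -> m%:R <= L / (8 * ln L) ->
  (64 * m.+1%:R)^-1 <= p <= 1 ->
  K%:R ^+ m * (1 - p ^+ (m.*2.+1)) ^+ (K - m) <= expR (- L).
Proof.
move=> L512 KL mL /andP[p_ge p1].
have L0 : 0 < L by lra.
set l := ln L in mL.
have lL : expR l = L by rewrite lnK.
have l1 : 1 <= l.
  rewrite -ler_expR lL.
  have h1 := expR_ge1Dx (- (1 / 2) : R).
  have h2 := expRxMexpNx_1 (1 / 2 : R).
  have -> : (1 : R) = 1 / 2 + 1 / 2 by lra.
  by rewrite expRD; move: h1 h2 (expR_gt0 (1 / 2 : R)) => *; nra.
have l8 : l <= L / 8.
  rewrite -ler_expR lL; have := @expR_ge_pow 1 (L / 8); rewrite expr2 => h.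
  by apply: le_trans (h _); nra.
have ml : m%:R * l <= L / 8.
  move: mL; rewrite ler_pdivlMr; [lra|nra].
have m_le : m%:R <= L / 8 by nra.
have p_exp : expR (- (2 * l)) <= p.
  apply: le_trans p_ge; rewrite expRN lef_pV2 ?posrE ?expR_gt0 ?mulr_gt0//.
  rewrite (_ : 2 * l = l + l); last by ring.
  rewrite expRD lL -natr1; nra.
pose x := p ^+ m.*2.+1.
have x_ge : expR (- (3 / 4 * L)) <= x.
  rewrite /x; apply: (@le_trans _ _ (expR (- (2 * l)) ^+ m.*2.+1)).
    have m2 : (m.*2.+1)%:R = 2 * m%:R + 1 :> R by rewrite -natr1 -mul2n natrM.
    rewrite -expRM_natl ler_expR m2; lra.
  by rewrite lerXn2r ?nnegrE ?expR_ge0// (le_trans _ p_exp)// expR_ge0.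
have p0 : 0 <= p by rewrite (le_trans _ p_exp)// expR_ge0.
have x1 : x <= 1 by rewrite exprn_ile1.
have mK2 : m%:R <= K%:R / 2 :> R.
  rewrite KL; apply: le_trans m_le _.
  by have := expR_ge1Dx L; lra.
have mK : (m <= K)%N by rewrite -(ler_nat R); move: (ler0n R K); lra.
have tail : (1 - x) ^+ (K - m) <= expR (- (expR (L / 4) / 2)).
  apply: (@le_trans _ _ (expR (- x) ^+ (K - m))).
    rewrite lerXn2r ?nnegrE ?expR_ge0 ?subr_ge0//.
    exact: expR_ge1Dx.
  rewrite -expRM_natl ler_expR mulrN lerN2 natrB//.
  apply: (@le_trans _ _ (K%:R / 2 * x)); last first.
    by rewrite ler_wpM2r ?exprn_ge0//; lra.
  rewrite mulrAC ler_pM2r// KL.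
  apply: (@le_trans _ _ (expR L * expR (- (3 / 4 * L)))).
    by rewrite -expRD ler_expR; lra.
  by rewrite ler_wpM2l ?expR_ge0.
have big : 2 * L ^+ 2 <= expR (L / 4) / 2.
  have h : (L / 4 / 4%:R) ^+ 4 <= expR (L / 4) by apply: expR_ge_pow; lra.
  have z32 : 32 <= L / 16 by lra.
  rewrite (_ : L / 4 / 4%:R = L / 16) in h; last by field.
  have LE : L = 16 * (L / 16) by lra.
  rewrite [X in 2 * X ^+ 2]LE.
  move: (L / 16) (expR _) z32 h => z e z32; rewrite !exprS !expr0 !mulr1 => h.
  have z2 : 1024 <= z * z by nra.
  nra.
rewrite KL -expRM_natl.
apply: (@le_trans _ _ (expR (m%:R * L) * expR (- (expR (L / 4) / 2)))).
  by rewrite ler_wpM2l ?expR_ge0.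
rewrite -expRD ler_expR; rewrite expr2 in big; nra.
Qed.

End Asymptotics.

Theorem theorem1 (R : realType) :
  exists c : R, 0 < c /\
    forall eps : R, 0 < eps ->
      exists K0 : nat, forall K : nat, (K0 <= K)%N ->
        exists B : set ((K * K).-tuple R),
          measurable B /\
          (forall th, B th ->
             sumrate_atleast (phases th) (c * (ln (K%:R) / ln (ln (K%:R))))) /\
          (phase_prob B >= (1 - eps)%:E)%E.
Proof.
exists 256^-1; split=> [|eps eps0]; first by rewrite invr_gt0.
pose T : R := 512 + `|ln eps|.
exists (Num.bound (expR T)) => K hK.
have KT : expR T <= K%:R.
  apply: le_trans (ltW (archi_boundP (expR_ge0 T))) _.
  by rewrite ler_nat.
have K0 : 0 < K%:R :> R by exact: lt_le_trans (expR_gt0 T) KT.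
set L := ln K%:R.
have KL : K%:R = expR L by rewrite lnK.
have TL : T <= L by rewrite -ler_expR -KL.
have L512 : 512 <= L by apply: le_trans TL; rewrite lerDl.
have Leps : expR (- L) <= eps.
  rewrite -[leRHS]lnK// ler_expR lerNl; apply: le_trans TL.
  by apply: le_trans (ler_norm _) _; rewrite normrN lerDr.
have lL : 0 < ln L by rewrite ln_gt0//; lra.
pose m := Num.truncn (L / (8 * ln L)).
have mL : m%:R <= L / (8 * ln L).
  by rewrite Num.Theory.truncn_le divr_ge0 ?mulr_ge0 ?ltW//; lra.
have mL' : L / (8 * ln L) <= m.+1%:R by rewrite ltW// Num.Theory.truncnS_gt.
pose w : R := (8 * m.+1%:R)^-1.
pose p : R := w / (2 * pi).
have pi2 := @pi_ge2 R; have /andP[_ pi4] := @pihalf_02 R.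
have m1 : 1 <= m.+1%:R :> R by rewrite ler1n.
have w0 : 0 < w by rewrite invr_gt0; lra.
have w1 : w < 1 by rewrite invf_lt1; lra.
have p_le : p <= 1 by rewrite ler_pdivrMr; lra.
have p_ge : (64 * m.+1%:R)^-1 <= p.
  rewrite /p /w -invfM lef_pV2 ?posrE; [|nra..].
  nra.
have p0 : 0 <= p by rewrite divr_ge0 ?ltW//; lra.
pose bits (th : (K * K).-tuple R) := [tuple tnth th i \in phase_set w i | i < K * K].
exists [set th | extensible m (bits th)]; split; [|split].
- have := @measurable_fin_preimage _ _ _ (fun (th : (K * K).-tuple R) i =>
    tnth th i \in phase_set w i) (fun g => extensible m [tuple g i | i < K * K]).
  apply=> i; rewrite (_ : [set x | _] = (fun th => tnth th i) @^-1` phase_set w i).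
    rewrite -[X in measurable X]setTI; apply: measurable_tnth => //.
    exact: measurable_phase_set.
  by apply/seteqP; split => x /=; rewrite inE.
- move=> th /extensible_clique[|S Sm hS]; first by rewrite -(ltr_nat R).
  exists (fun k => if k \in S then 32^-1 else 0); split.
    apply: aligned_achievable; apply: aligned_of_phase_set Sm _ => k j kS jS.
    by have := hS k j kS jS; rewrite tnth_mktuple inE.
  rewrite -big_mkcond/= sumr_const Sm -[leRHS]mulr_natl.
  have : L / (8 * ln L) = L / ln L / 8 by rewrite invfM mulrA mulrAC.
  by move: mL'; rewrite -/L; lra.
- rewrite /phase_prob.
  have -> : (fun th : (K * K).-tuple R =>
      (\1_[set th | extensible m (bits th)] th)%:E) =
      (fun th => (extensible m (bits th))%:R%:E : \bar R).
    by apply/funext => th; rewrite indicE mem_setE.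
  rewrite (@texp_phase_bits _ p _ (phase_set w) (fun b => (extensible m b)%:R)).
  + rewrite lee_fin; apply: le_trans (bexp_extensible K m _); last by rewrite p0.
    rewrite lerB//; apply: le_trans Leps.
    by apply: failure_small => //; rewrite p_ge.
  + exact: measurable_phase_set.
  + by move=> i; exact: phase_set_sub.
  + move=> i; rewrite lebesgue_phase_set//; congr EFin.
    by rewrite /p mulrC divfK// gt_eqF//; lra.
Qed.
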